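(* Let $q$ be a prime power, let $C$ be an $[n,k,d]_q$ Griesmer code (i.e. $n=g_q(k,d)$), and let $s=\lceil d/q^{k-1}\rceil$. Suppose that $k'<k$ is the maximum rank of an $\{sv_k-n,\ sv_{k-1}-n+d;\ k-1,q\}$-minihyper in $PG(k-1,q)$. Then $$A_d(C)\ge L_q^{(5)}(n,k):=q^{k-k'}\,e\big(n+sv_{k'}-sv_k,\ k',\ q\big).$$
   Context: An $[n,k,d]_q$ linear code is a $k$-dimensional subspace of $\mathbb{F}_q^n$ with minimum nonzero Hamming weight $d$; $A_d(C)$ is its number of weight-$d$ codewords. $g_q(k,d)=\sum_{i=0}^{k-1}\lceil d/q^i\rceil$ and $v_j=(q^j-1)/(q-1)$. $d(n,k,q)$ is the largest minimum distance of an $[n,k]_q$ linear code; $e(n,k,q)$ is the smallest value of $A_{d(n,k,q)}(C)$ over all $[n,k,d(n,k,q)]_q$ codes. A multiset in $PG(k-1,q)$ assigns a non-negative integer multiplicity to each point; for a set $Q$ of points its value is the sum of multiplicities. An $\{f,m;k-1,q\}$-minihyper is a multiset of total multiplicity $f$ with value at least $m$ on every hyperplane and exactly $m$ on some hyperplane. Its rank is the rank of the matrix whose columns are vector representatives of its points, repeated according to multiplicity. (The minihyper associated with $C$ assigns to each point $\mathbf{p}$ the value $s$ minus the number of columns of a generator matrix of $C$ that are scalar multiples of $\mathbf{p}$; it is an $\{sv_k-n,sv_{k-1}-n+d;k-1,q\}$-minihyper.) *)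

(* Defs.v *)
From HB Require Import structures.
From mathcomp Require Import all_boot all_order all_algebra all_field.
Set Implicit Arguments. Unset Strict Implicit. Unset Printing Implicit Defensive.
Import GRing.Theory.
Local Open Scope ring_scope.

Definition ceildiv (a b : nat) : nat := ((a + b.-1) %/ b)%N.

Definition griesmer (q k d : nat) : nat := (\sum_(i < k) ceildiv d (q ^ i))%N.

Definition vq (q j : nat) : nat := ((q ^ j - 1) %/ (q - 1))%N.

Section Codes.
Variable F : finFieldType.

Definition wt n (c : 'rV[F]_n) : nat := #|[set i : 'I_n | c 0 i != 0]|.

(* A linear code of length n is the row space of a square matrix C : 'M[F]_n;
   its dimension is \rank C and its codewords are the c with (c <= C)%MS. *)
Definition mindist n (C : 'M[F]_n) : nat :=
  \big[minn/n]_(c : 'rV[F]_n | (c <= C)%MS && (c != 0)) wt c.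

Definition Aw n (w : nat) (C : 'M[F]_n) : nat :=
  #|[set c : 'rV[F]_n | [&& (c <= C)%MS, c != 0 & wt c == w]]|.

Definition dmax (n k : nat) : nat :=
  \max_(C : 'M[F]_n | \rank C == k) mindist C.

Definition emin (n k : nat) : nat :=
  \big[minn/#|'rV[F]_n|]_(C : 'M[F]_n | (\rank C == k) && (mindist C == dmax n k))
     Aw (mindist C) C.

(* A multiset of points of PG(k-1,q) is given by a list of nonzero vector
   representatives of its points, each point repeated according to its
   multiplicity.  Hyperplanes are kernels of nonzero linear forms u. *)
Definition hyp_value k (P : seq 'rV[F]_k) (u : 'rV[F]_k) : nat :=
  count (fun x => x *m u^T == 0) P.

Definition is_minihyper k (f m : nat) (P : seq 'rV[F]_k) : Prop :=
  [/\ all (fun x => x != 0) P,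
      size P = f,
      (forall u : 'rV[F]_k, u != 0 -> (m <= hyp_value P u)%N) &
      exists2 u : 'rV[F]_k, u != 0 & hyp_value P u = m].

Definition mh_rank k (P : seq 'rV[F]_k) : nat :=
  \rank (\matrix_(i < size P) nth 0 P i).

End Codes.

(* Main.v *)
Require Import Defs.
From HB Require Import structures.
From mathcomp Require Import all_boot all_order all_algebra all_field.
From mathcomp Require Import zify.

(* View the columns of a generator matrix of [C] as a multiset [X] of points, so
   that codewords are linear forms [u].  The Griesmer bound for subcodes and
   punctured codes shows that [X] has no zero column and no point of multiplicity
   greater than [s]; hence [s] minus the multiplicity in [X] defines a minihyper,
   and it lives in a subspace [B] of dimension [k'].  Outside [B] every point has
   multiplicity [s] in [X], so the part of [X] inside [B] is again a code [Y] whose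
   weights differ from those of [C] by the constant [s (q^(k-1) - q^(k'-1))] on
   forms not vanishing on [B].  The Griesmer bound shows that [Y] is optimal, and each
   minimum weight word of [Y] extends to [q^(k-k')] minimum weight words of [C]. *)

Set Implicit Arguments. Unset Strict Implicit. Unset Printing Implicit Defensive.
Import Order.Theory GRing.Theory.

(** * Minima over finite families and arithmetic of the Griesmer sum *)

Lemma bigminn_le (I : finType) (x : nat) (j : I) (P : pred I) (f : I -> nat) :
  P j -> \big[minn/x]_(i | P i) f i <= f j.
Proof. exact: (@bigmin_le_cond _ nat I x j P f). Qed.

Lemma bigminn_ge (I : finType) (x m : nat) (P : pred I) (f : I -> nat) :
  m <= x -> (forall i, P i -> m <= f i) -> m <= \big[minn/x]_(i | P i) f i.
Proof. by move=> mx mf; apply/(@bigmin_geP _ nat I x m P f). Qed.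

Lemma ceildiv_le (a b c : nat) : 0 < b -> (ceildiv a b <= c) = (a <= c * b).
Proof.
move=> b_gt0; rewrite /ceildiv -ltnS ltn_divLR // mulSn.
by case: b b_gt0 => //= b _; lia.
Qed.

Lemma ceildiv_mono (a a' b : nat) : 0 < b -> a <= a' -> ceildiv a b <= ceildiv a' b.
Proof.
by move=> b_gt0 le_a; rewrite ceildiv_le // (leq_trans le_a) // -ceildiv_le.
Qed.

Lemma ceildiv1 (a : nat) : ceildiv a 1 = a.
Proof. by rewrite /ceildiv addn0 divn1. Qed.

(** By [ceildiv_le] the two sides have the same upper bounds. *)
Lemma ceildiv_ceildiv (a b c : nat) :
  0 < b -> 0 < c -> ceildiv (ceildiv a b) c = ceildiv a (b * c).
Proof.
move=> b_gt0 c_gt0; apply/eqP; rewrite eqn_leq !ceildiv_le ?muln_gt0 ?b_gt0 //.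
rewrite -mulnA [c * b]mulnC -ceildiv_le ?muln_gt0 ?b_gt0 // leqnn /=.
by rewrite [b * c]mulnC mulnA -!ceildiv_le.
Qed.

Lemma ceildivMDl (a b c : nat) : 0 < b -> ceildiv (c * b + a) b = c + ceildiv a b.
Proof. by move=> b_gt0; rewrite /ceildiv -addnA divnMDl. Qed.

Lemma griesmer_mono (q k d d' : nat) : 0 < q -> d <= d' -> griesmer q k d <= griesmer q k d'.
Proof. by move=> q0 le_d; apply: leq_sum => i _; rewrite ceildiv_mono ?expn_gt0 ?q0. Qed.

(** The numerical shadow of passing to a residual code, whose distance is at least [ceildiv d q]; it
    drives the induction in [griesmer_bound]. *)
Lemma griesmerSl (q k d : nat) :
  0 < q -> griesmer q k.+1 d = d + griesmer q k (ceildiv d q).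
Proof.
move=> q_gt0; rewrite /griesmer big_ord_recl expn0 ceildiv1; congr addn.
by apply: eq_bigr => i _; rewrite ceildiv_ceildiv ?expn_gt0 ?q_gt0 // -expnS.
Qed.

Lemma griesmer_ltS (q k d : nat) :
  0 < q -> 0 < k -> griesmer q k d < griesmer q k d.+1.
Proof.
case: k => // k q_gt0 _; rewrite !griesmerSl // addSn ltnS leq_add2l.
by rewrite griesmer_mono ?ceildiv_mono.
Qed.

Lemma griesmerd0 (q k : nat) : 0 < q -> griesmer q k 0 = 0.
Proof.
move=> q_gt0; rewrite /griesmer big1 // => i _.
by apply/eqP; rewrite -leqn0 ceildiv_le ?expn_gt0 ?q_gt0.
Qed.

Lemma vqE (q j : nat) : 1 < q -> vq q j = \sum_(i < j) q ^ i.
Proof.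
by move=> q_gt1; rewrite /vq !subn1 predn_exp mulKn //; case: q q_gt1 => [|[]].
Qed.

Lemma vqS (q j : nat) : 1 < q -> vq q j.+1 = vq q j + q ^ j.
Proof. by move=> q_gt1; rewrite !vqE // big_ord_recr. Qed.

(** These are the parameters of [s] copies of the simplex code; every division in the Griesmer sum
    is exact. *)
Lemma griesmer_simplex (q k s : nat) : 1 < q -> griesmer q k (s * q ^ k.-1) = s * vq q k.
Proof.
move=> q_gt1; have q_gt0 : 0 < q by apply: ltnW.
elim: k => [|[|k] IHk]; first by rewrite vqE // /griesmer !big_ord0 muln0.
  by rewrite griesmerSl // vqE // /griesmer big_ord0 big_ord1 addn0.
rewrite griesmerSl // vqS // mulnDr addnC -IHk /= expnSr mulnA.
by rewrite -[s * q ^ k * q]addn0 ceildivMDl // /ceildiv divn_small ?addn0 // add0n prednK.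
Qed.

(** With [s * vq q j] written as the sum of [s * q ^ (j.-1 - i)], compare term by term. For [i < k']
    the terms agree, since multiples of [q ^ i] pass through the ceiling; for [k' <= i < k] the
    bound on [d] gives [ceildiv d (q ^ i) <= s * q ^ (k.-1 - i)]. *)
Lemma griesmer_simplexB (q k k' s d d' : nat) :
  1 < q -> k' <= k -> d <= s * q ^ k.-1 ->
  d' + s * q ^ k.-1 = d + s * q ^ k'.-1 ->
  griesmer q k d + s * vq q k' <= griesmer q k' d' + s * vq q k.
Proof.
move=> q_gt1 le_k' le_d def_d'.
have revsum j : s * vq q j = \sum_(0 <= i < j) s * q ^ (j.-1 - i).
  rewrite vqE // big_distrr /= big_mkord (reindex_inj rev_ord_inj) /=.
  by apply: eq_bigr => -[i lt_ij] _; congr (_ * _ ^ _); case: j lt_ij => //= j _; rewrite subSS.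
have qX i : 0 < q ^ i by rewrite expn_gt0 ltnW.
have splitX j i : i < j -> s * q ^ j.-1 = s * q ^ (j.-1 - i) * q ^ i.
  by case: j => //= j le_ij; rewrite -mulnA -expnD subnK.
rewrite !revsum /griesmer -!(big_mkord predT (fun i => ceildiv _ (q ^ i))).
rewrite !(big_cat_nat (leq0n k') le_k') //= addnAC -big_split addnA -big_split /=.
apply: leq_add; last first.
  rewrite big_nat_cond [X in _ <= X]big_nat_cond.
  apply: leq_sum => i /andP[/andP[_ lt_ik] _].
  by rewrite ceildiv_le // -splitX.
rewrite big_nat_cond [X in _ <= X]big_nat_cond.
apply: leq_sum => i /andP[/andP[_ lt_ik'] _].
have lt_ik : i < k by apply: leq_trans le_k'.
rewrite [X in X <= _]addnC [X in _ <= X]addnC -!ceildivMDl // -!splitX //.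
by rewrite addnC -def_d' addnC.
Qed.

(** * Weights of linear forms on a multiset of vectors, and the Griesmer bound *)

Section Geometry.
Variable F : finFieldType.
Local Notation q := #|F|.

Let q_gt1 : 1 < q. Proof. exact: card_finNzRing_gt1. Qed.
Let q_gt0 : 0 < q. Proof. exact: ltnW. Qed.

Definition colwt k (X : seq 'rV[F]_k) (u : 'rV[F]_k) : nat :=
  count (fun x => x *m u^T != 0)%R X.

Lemma colwtE k (X : seq 'rV[F]_k) u : hyp_value X u + colwt X u = size X.
Proof. exact: count_predC. Qed.

Lemma dot_eq0C k (x u : 'rV[F]_k) : (x *m u^T == 0)%R = (u *m x^T == 0)%R.
Proof. by rewrite -[in RHS]trmx_eq0 trmx_mul trmxK. Qed.

Lemma colwt_le_size k (X : seq 'rV[F]_k) u : colwt X u <= size X.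
Proof. exact: count_size. Qed.

(* For [x u0 != 0] exactly one [a] kills [x (v - a u0)]; the others contribute
   [q] or [0] according to [x v]. *)
Lemma sum_colwt_line k (X : seq 'rV[F]_k) (u0 v : 'rV[F]_k) :
  \sum_(a : F) colwt X (v - a *: u0)%R =
  q.-1 * colwt X u0 + q * colwt [seq x <- X | (x *m u0^T == 0)%R] v.
Proof.
elim: X => [|x X IHX]; first by rewrite /colwt /= !muln0 big1.
rewrite /colwt /= big_split /= -/(colwt _ _).
under [X in _ + X = _]eq_bigr do rewrite -/(colwt X _).
rewrite {}IHX -/(colwt X u0) mulnDr -addnA; case: eqP => [xu0|/eqP xu0] /=.
  rewrite -/(colwt _ _) muln0 add0n mulnDr addnCA; congr (_ + (_ + _)).
  rewrite (eq_bigr (fun=> nat_of_bool (x *m v^T != 0)%R)) ?sum_nat_const //.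
  by move=> a _; rewrite linearB linearZ /= mulmxBr -scalemxAr xu0 scaler0 subr0.
rewrite -/(colwt _ _) muln1; congr addn.
have [c cE] : exists c, forall a, (x *m (v - a *: u0)^T != 0)%R = (a != c).
  exists ((x *m v^T) 0 0 / (x *m u0^T) 0 0)%R => a.
  have nz0 M : (M : 'M[F]_1) = 0%R <-> (M 0 0 = 0)%R.
    by split=> [->|M0]; [rewrite mxE | apply/matrixP=> i j; rewrite !ord1 M0 mxE].
  have xu00 : ((x *m u0^T) 0 0 != 0)%R by apply: contraNneq xu0 => /nz0->.
  have dotE : ((x *m (v - a *: u0)^T) 0 0 = (x *m v^T) 0 0 - a * (x *m u0^T) 0 0)%R.
    rewrite linearB linearZ /= mulmxBr -scalemxAr.
    by move: (x *m v^T)%R (x *m u0^T)%R => A B; rewrite !mxE.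
  congr (~~ _); apply/eqP/eqP => [/nz0|a_eq]; last apply/nz0; rewrite dotE.
    by move/eqP; rewrite subr_eq0 => /eqP->; rewrite mulfK.
  by rewrite a_eq divfK ?subrr.
under eq_bigr do rewrite cE.
by rewrite -(cardC1 c) -sum1_card [RHS]big_mkcond; apply: eq_bigr => a _; rewrite inE; case: eqP.
Qed.

(** The residual code argument: keep only the vectors killed by a form [u0] of least weight and
    recurse on a complement of [u0]. Letting the forms range over a subspace [U] covers subcodes
    without a change of coordinates. *)
Lemma griesmer_bound k (X : seq 'rV[F]_k) (U : 'M[F]_k) d :
  (forall u : 'rV[F]_k, (u <= U)%MS -> u != 0%R -> d <= colwt X u) ->
  griesmer q (\rank U) d <= size X.
Proof.
move rE : (\rank U) => r; elim: r => [|r IHr] in X U d rE *; first by rewrite /griesmer big_ord0.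
move=> Xd.
have [u U_u nz_u] : exists2 u : 'rV[F]_k, (u <= U)%MS & u != 0%R.
  have nzU : U != 0%R by rewrite -mxrank_eq0 rE.
  by exists (nz_row U); rewrite ?nz_row_sub ?nz_row_eq0.
pose P v := (v <= U)%MS && (v != 0%R :> 'rV[F]_k).
have Pu : P u by apply/andP.
case: (arg_minnP (colwt X) Pu) => u0 /andP[U_u0 nz_u0] min_u0.
set w := colwt X u0 in min_u0.
have le_dw : d <= w by apply: Xd.
rewrite (leq_trans (griesmer_mono _ _ le_dw)) // griesmerSl //.
pose X' := [seq x <- X | (x *m u0^T == 0)%R].
have -> : size X = w + size X' by rewrite -(colwtE X u0) size_filter addnC.
rewrite leq_add2l; apply: (IHr _ (U :\: u0)%MS).
  have := mxrank_cap_compl U u0; rewrite rE.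
  have/capmx_idPr/eqmxP/eqmx_rank-> := U_u0.
  by rewrite rank_rV nz_u0 => -[].
move=> v U'v nz_v; rewrite ceildiv_le //.
(* All [q] forms [v - a u0] are nonzero and lie in [U], so each has weight at least [w]. By
   [sum_colwt_line] the total is [(q - 1) w + q * colwt X' v], whence [w <= q * colwt X' v]. *)
have lines : q * w <= \sum_(a : F) colwt X (v - a *: u0)%R.
  rewrite -sum_nat_const leq_sum // => a _; apply: min_u0; apply/andP; split.
    rewrite addmx_sub ?eqmx_opp ?scalemx_sub //.
    exact: submx_trans U'v (diffmxSl _ _).
  apply: contraNneq nz_v => /eqP; rewrite subr_eq0 => /eqP v_au0.
  rewrite -submx0 -(capmx_diff U u0) sub_capmx U'v v_au0; exact: scalemx_sub.
rewrite sum_colwt_line -/w -/X' in lines.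
rewrite mulnC -(leq_add2l (q.-1 * w)) (leq_trans _ lines) //.
by rewrite -mulSnr prednK.
Qed.

(** * Codes as multisets of columns of a generator matrix *)

Definition columns r n (G : 'M[F]_(r, n)) : seq 'rV[F]_r :=
  [seq (col j G)^T | j <- enum 'I_n]%R.

Lemma size_columns r n (G : 'M[F]_(r, n)) : size (columns G) = n.
Proof. by rewrite size_map size_enum_ord. Qed.

Lemma columns_surj r (Y : seq 'rV[F]_r) :
  exists G : 'M[F]_(r, size Y), columns G = Y.
Proof.
exists (\matrix_(i, j) (tnth (in_tuple Y) j) ord0 i)%R.
rewrite -[RHS](map_tnth_enum (in_tuple Y)); apply: eq_map => j.
by apply/rowP=> i; rewrite !mxE.
Qed.

Lemma wt_mulmx r n (G : 'M[F]_(r, n)) w : wt (w *m G)%R = colwt (columns G) w.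
Proof.
rewrite /wt /colwt count_map cardsE cardE size_filter -enumT; apply: eq_count => j /=.
have -> : ((col j G)^T *m w^T = (col j (w *m G))^T)%R.
  by rewrite -trmx_mul !colE mulmxA.
rewrite trmx_eq0; congr (~~ _); apply/eqP/eqP => [wG0|/colP/(_ ord0)]; last by rewrite !mxE.
by apply/colP=> i; rewrite !ord1 mxE wG0 mxE.
Qed.

Section Code.
Variables (r n : nat) (C : 'M[F]_n) (G : 'M[F]_(r, n)).
Hypotheses (freeG : row_free G) (eqGC : (G :=: C)%MS).

Lemma codewordP c :
  reflect (exists2 w : 'rV[F]_r, w != 0%R & c = (w *m G)%R) ((c <= C)%MS && (c != 0%R)).
Proof.
rewrite -eqGC; apply: (iffP andP) => [[/submxP[w ->] nz]|[w nz ->]].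
  by exists w => //; apply: contraNneq nz => ->; rewrite mul0mx.
split; first exact: submxMl.
by apply: contraNneq nz => wG0; rewrite -[w](mulmxKp freeG) wG0 mul0mx.
Qed.

Lemma mindist_le w : w != 0%R -> mindist C <= colwt (columns G) w.
Proof.
by move=> nz; rewrite -wt_mulmx; apply: bigminn_le; apply/codewordP; exists w.
Qed.

Lemma mindist_ge d : 0 < r ->
  (forall w, w != 0%R -> d <= colwt (columns G) w) -> d <= mindist C.
Proof.
move=> r_gt0 Gd; apply: bigminn_ge => [|c /codewordP[w nz ->]]; last by rewrite wt_mulmx Gd.
(* The default value [n] of the minimum must also be at least [d]: any nonzero form has weight
   between [d] and [n]. *)
case: r r_gt0 G Gd => // r' _ G' Gd.
have nz : const_mx 1%R != 0%R :> 'rV[F]_r'.+1.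
  by apply/eqP=> /rowP/(_ ord0)/eqP; rewrite !mxE oner_eq0.
by apply: leq_trans (Gd _ nz) _; rewrite -[X in _ <= X](size_columns G') colwt_le_size.
Qed.

Lemma mindist_attained : 0 < r ->
  exists2 w, w != 0%R & colwt (columns G) w = mindist C.
Proof.
move=> r_gt0; pose P w := (w != 0%R) && (colwt (columns G) w == mindist C).
have [/existsP[w /andP[nz /eqP wd]]|/existsPn Gd] := boolP [exists w, P w]; first by exists w.
(* If no form attained the minimum, [mindist_ge] would improve it by one. *)
suffices: (mindist C).+1 <= mindist C by rewrite ltnn.
apply: mindist_ge => // w nz; rewrite ltn_neqAle mindist_le // andbT eq_sym.
by move: (Gd w); rewrite /P nz.
Qed.

Lemma Aw_colwt d : Aw d C = #|[set w | (w != 0%R) && (colwt (columns G) w == d)]|.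
Proof.
rewrite -(card_imset _ (can_inj (mulmxKp (p := 1) freeG))); apply: eq_card => c.
rewrite inE andbA; apply/andP/imsetP => [[/codewordP[w nz ->]]|[w]].
  by rewrite wt_mulmx => wd; exists w; rewrite // inE nz.
by rewrite inE => /andP[nz wd] ->; rewrite wt_mulmx; split=> //; apply/codewordP; exists w.
Qed.

End Code.

Lemma griesmer_mindist n (C : 'M[F]_n) :
  0 < \rank C -> griesmer q (\rank C) (mindist C) <= n.
Proof.
move=> C_gt0; rewrite -[X in _ <= X](size_columns (row_base C)).
rewrite -[X in griesmer _ X _](mxrank1 F); apply: griesmer_bound => w _.
exact: (mindist_le (row_base_free C) (eq_row_base C)).
Qed.

(** * Upper bounds for [emin] *)

Lemma emin_le_space n r : emin F n r <= #|{: 'rV[F]_n}|.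
Proof. exact: (@bigmin_le_id _ nat). Qed.

(** The zero code has no nonzero words, and [Aw] counts no others. In rank 0 [mindist] takes its
    default value [n], so the zero code is optimal. *)
Lemma emin0 n : emin F n 0 = 0.
Proof.
have mindist0 (C : 'M[F]_n) : \rank C = 0 -> mindist C = n.
  move/eqP; rewrite mxrank_eq0 => /eqP->.
  by apply: big_pred0 => c; rewrite submx0 andbN.
apply/eqP; rewrite -leqn0; pose C : 'M[F]_n := 0%R.
have C0 : \rank C = 0 by rewrite mxrank0.
suffices le_Aw : emin F n 0 <= Aw (mindist C) C.
  apply: leq_trans le_Aw _; rewrite leqn0 /Aw; apply/eqP/eq_card0 => c.
  by rewrite inE submx0 andbA andbN.
apply: (@bigminn_le _ _ C); rewrite /= C0 mindist0 //= eqn_leq.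
rewrite -[X in X <= _](mindist0 C C0) (leq_bigmax_cond (F := @mindist F n)) ?C0 //=.
by apply/bigmax_leqP => D /eqP/mindist0->.
Qed.

(** A multiset no longer than the Griesmer bound gives a code of the largest possible distance, so
    its number of minimum weight words competes in [emin]. *)
Lemma emin_le r (Y : seq 'rV[F]_r) d :
    0 < r -> (forall w, w != 0%R -> d <= colwt Y w) ->
    (exists2 w, w != 0%R & colwt Y w = d) -> size Y <= griesmer q r d ->
  emin F (size Y) r <= #|[set w | (w != 0%R) && (colwt Y w == d)]|.
Proof.
move=> r_gt0 Yd [w0 nz_w0 w0d] sizeY.
have A_gt0 : 0 < #|[set w | (w != 0%R) && (colwt Y w == d)]|.
  by apply/card_gt0P; exists w0; rewrite inE nz_w0 w0d eqxx.
(* For [d = 0] the multiset is empty and yields no code of dimension [r]; but then [emin] is at most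
   the number of vectors of length 0, which is 1. *)
case: (posnP d) => [d0|d_gt0].
  have sizeY0 : size Y = 0 by move: sizeY; rewrite d0 griesmerd0 // leqn0 => /eqP.
  by rewrite (leq_trans (emin_le_space _ _)) // card_mx sizeY0 muln0.
have [G GY] := columns_surj Y.
have colG w : colwt (columns G) w = colwt Y w by rewrite GY.
have freeG : row_free G.
  apply: inj_row_free => w wG0; apply: contraTeq d_gt0 => /Yd.
  rewrite -colG -wt_mulmx wG0 /wt -leqNgt => /leq_trans-> //.
  by rewrite leqn0 cards_eq0; apply/eqP/setP=> i; rewrite !inE mxE eqxx.
pose C := <<G>>%MS; have eqGC : (G :=: C)%MS by apply/eqmx_sym/genmxE.
have minC : mindist C = d.
  apply/eqP; rewrite eqn_leq -{1}w0d -colG (mindist_le freeG) //=.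
  by apply: (mindist_ge freeG eqGC) => // w nz; rewrite colG Yd.
have -> : #|[set w | (w != 0%R) && (colwt Y w == d)]| = Aw (mindist C) C.
  by rewrite (Aw_colwt freeG eqGC) minC; apply: eq_card => w; rewrite !inE colG.
have rankC : \rank C = r by rewrite -eqGC; apply/eqP.
apply: (@bigminn_le _ _ C); rewrite rankC eqxx /= eqn_leq.
rewrite (leq_bigmax_cond (F := @mindist F _)) ?rankC //=.
(* A code [D] of larger distance would need length at least [griesmer q r d.+1], which exceeds
   [griesmer q r d]. *)
apply/bigmax_leqP => D /eqP rankD; rewrite minC leqNgt; apply/negP => ltD.
have := leq_trans (griesmer_mono _ q_gt0 ltD) (griesmer_mindist _).
rewrite rankD => /(_ r_gt0)/leq_trans/(_ sizeY).
by rewrite leqNgt griesmer_ltS.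
Qed.

(** * Counting vectors, and counting projective points through canonical representatives *)

Lemma card_rowspace m n (A : 'M[F]_(m, n)) :
  #|[set u : 'rV[F]_n | (u <= A)%MS]| = q ^ \rank A.
Proof.
have := card_imset [set: 'rV[F]_(\rank A)] (can_inj (mulmxKp (p := 1) (row_base_free A))).
rewrite cardsT card_mx mul1n => <-; apply: eq_card => u; rewrite inE -(eq_row_base A).
by apply/submxP/imsetP => [[w ->]|[w _ ->]]; exists w.
Qed.

Lemma card_mulmx_fiber m n (A : 'M[F]_(m, n)) (v : 'rV[F]_m) :
  #|[set u : 'rV[F]_m | (u *m A == v *m A)%R]| = q ^ (m - \rank A).
Proof.
rewrite -mxrank_ker -card_rowspace -[RHS](card_imset _ (addrI v)); apply: eq_card => u.
rewrite inE -subr_eq0 -mulmxBl; apply/eqP/imsetP => [uv0|[w]].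
  by exists (u - v)%R; rewrite ?subrKC // inE; apply/sub_kermxP.
by rewrite inE => /sub_kermxP wA ->; rewrite addrAC subrr add0r.
Qed.

(** The coordinate found by [pick] depends only on the support of [x], so proportional nonzero
    vectors get the same representative. *)
Definition point_rep k (x : 'rV[F]_k) : 'rV[F]_k :=
  if [pick i | x ord0 i != 0%R] is Some i then ((x ord0 i)^-1 *: x)%R else 0%R.

Lemma point_repZ k (a : F) (x : 'rV[F]_k) :
  a != 0%R -> point_rep (a *: x)%R = point_rep x.
Proof.
move=> nz_a; rewrite /point_rep.
rewrite (eq_pick (Q := fun i => x ord0 i != 0%R)) => [|i]; last by rewrite mxE mulf_eq0 negb_or nz_a.
by case: pickP => // i _; rewrite mxE scalerA invfM mulrAC mulVf // mul1r.
Qed.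

Lemma point_repE k (x : 'rV[F]_k) : exists2 a, a != 0%R & point_rep x = (a *: x)%R.
Proof.
rewrite /point_rep; case: pickP => [i nz|x0]; first by exists (x ord0 i)^-1%R; rewrite ?invr_eq0.
exists 1%R; rewrite ?oner_eq0 // scale1r; apply/rowP => i.
by rewrite mxE; apply/esym/eqP; rewrite -[_ == _]negbK x0.
Qed.

Definition points k : {set 'rV[F]_k} := [set x | (x != 0%R) && (point_rep x == x)].

Lemma point_rep_id k (x : 'rV[F]_k) : point_rep (point_rep x) = point_rep x.
Proof. by have [a nz_a {1}->] := point_repE x; rewrite point_repZ. Qed.

Lemma point_rep_in k (x : 'rV[F]_k) : x != 0%R -> point_rep x \in points k.
Proof.
rewrite inE point_rep_id eqxx andbT.
by have [a nz_a ->] := point_repE x; rewrite scaler_eq0 (negPf nz_a).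
Qed.

(** Such predicates are well defined on points of the projective space. *)
Definition projective k (p : pred 'rV[F]_k) : Prop :=
  forall (a : F) x, a != 0%R -> p (a *: x)%R = p x.

Lemma projective_rep k (p : pred 'rV[F]_k) x : projective p -> p (point_rep x) = p x.
Proof. by move=> proj; have [a nz_a ->] := point_repE x; rewrite proj. Qed.

(** Each point has [q - 1] nonzero representatives: [(y, a)] maps bijectively to [a y]. *)
Lemma card_points_mul k (p : pred 'rV[F]_k) : projective p ->
  #|[set x in points k | p x]| * q.-1 = #|[set x | (x != 0%R) && p x]|.
Proof.
move=> proj; rewrite -(cardC1 (0%R : F)) -[#|predC1 _|]cardsE -cardsX.
pose h (y : 'rV[F]_k * F) := (y.2 *: y.1)%R.
rewrite -(card_in_imset (f := h)); last first.
  move=> [x a] [y b]; rewrite !inE /h /= => /andP[/andP[/andP[nz_x /eqP xE] _] nz_a].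
  move=> /andP[/andP[/andP[_ /eqP yE] _] nz_b] eq_xy.
  have xy : x = y by rewrite -xE -yE -(point_repZ x nz_a) eq_xy point_repZ.
  move: eq_xy; rewrite -{}xy => /eqP; rewrite -subr_eq0 -scalerBl scaler_eq0.
  by rewrite (negPf nz_x) orbF subr_eq0 => /eqP->.
apply: eq_card => x; rewrite inE; apply/imsetP/andP => [[[y a]]|[nz_x px]].
  rewrite !inE /= => /andP[/andP[/andP[nz_y _] py] nz_a] ->.
  by rewrite scaler_eq0 negb_or nz_a proj.
have [a nz_a xE] := point_repE x.
exists (point_rep x, a^-1)%R; last by rewrite /h /= xE scalerA mulVf // scale1r.
have [rep_x nz_a'] : point_rep x \in points k /\ (a^-1 != 0)%R by rewrite point_rep_in ?invr_eq0.
by rewrite in_setX /= inE rep_x projective_rep // px !inE.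
Qed.

Lemma projective_sub k m (A : 'M[F]_(m, k)) : projective (fun x => x <= A)%MS.
Proof. by move=> a x nz_a; rewrite eqmx_scale. Qed.

Lemma projective_dot k (u : 'rV[F]_k) : projective (fun x => x *m u^T != 0)%R.
Proof. by move=> a x nz_a; rewrite -scalemxAl scaler_eq0 negb_or nz_a. Qed.

Lemma projectiveI k (p1 p2 : pred 'rV[F]_k) :
  projective p1 -> projective p2 -> projective (predI p1 p2).
Proof. by move=> proj1 proj2 a x nz_a /=; rewrite proj1 ?proj2. Qed.

Lemma card_points_sub k m (A : 'M[F]_(m, k)) :
  #|[set x in points k | (x <= A)%MS]| = vq q (\rank A).
Proof.
rewrite /vq !subn1 -[LHS](@mulnK _ q.-1); last by rewrite -ltnS prednK.
rewrite card_points_mul; last exact: projective_sub.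
congr (_ %/ _); rewrite -card_rowspace [in RHS](cardsD1 0%R) [in RHS]inE sub0mx add1n [RHS]/=.
by apply: eq_card => x; rewrite !inE.
Qed.

Lemma card_points_sub_dot k m (A : 'M[F]_(m, k)) (u : 'rV[F]_k) : (A *m u^T != 0)%R ->
  #|[set x in points k | (x <= A)%MS && (x *m u^T != 0)%R]| = q ^ (\rank A).-1.
Proof.
move=> Au; have rank_Au : \rank (A *m u^T)%R = 1.
  by apply/eqP; rewrite eqn_leq rank_leq_col lt0n mxrank_eq0.
have := mxrank_mul_ker A u^T%R; rewrite rank_Au add1n => rankA.
have := @card_points_mul k (fun x => (x <= A)%MS && (x *m u^T != 0)%R)
  (projectiveI (projective_sub A) (projective_dot u)).
suffices -> : #|[set x : 'rV[F]_k | x != 0%R & (x <= A)%MS && (x *m u^T != 0)%R]| = q ^ (\rank A).-1 * q.-1.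
  by move/eqP; rewrite eqn_pmul2r ?(inj_eq) => [/eqP//|]; rewrite -ltnS prednK.
(* Adding the [q ^ (\rank A).-1] vectors of [A] killed by [u] completes the count to all of [A]. *)
apply/eqP; rewrite -(eqn_add2r (q ^ (\rank A).-1)) -mulnSr prednK // -expnSr -rankA /=.
rewrite -{1}card_rowspace rankA -card_rowspace.
rewrite -(cardsID [set x : 'rV[F]_k | (x *m u^T != 0)%R] [set x : 'rV[F]_k | (x <= A)%MS]).
apply/eqP; congr (_ + _); apply: eq_card => x; rewrite !inE.
  by apply: andb_idl => /andP[_]; apply: contraNneq => ->; rewrite mul0mx.
by rewrite sub_capmx (sameP sub_kermxP eqP) negbK andbC.
Qed.

(** * The complement of a multiset in [s] copies of the projective space *)

Definition mset_compl s k (X : seq 'rV[F]_k) : seq 'rV[F]_k :=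
  flatten [seq nseq (s - count (fun y => point_rep y == x) X) x | x <- enum (points k)].

(** Sort [X] by points: the bound on multiplicities makes the truncated subtraction exact, so each
    point counts [s] times in the two multisets together. *)
Lemma count_mset_compl s k (X : seq 'rV[F]_k) (p : pred 'rV[F]_k) :
    projective p -> all (fun x => x != 0%R) X ->
    (forall x, x \in points k -> count (fun y => point_rep y == x) X <= s) ->
  count p (mset_compl s X) + count p X = s * #|[set x in points k | p x]|.
Proof.
move=> proj nzX multX.
have -> : count p X =
    \sum_(x in points k) p x * count (fun y => point_rep y == x) X.
  elim: X nzX {multX} => [|y X IHX] /=; first by rewrite big1 // => x _; rewrite muln0.
  case/andP => nz_y /IHX->.
  under [RHS]eq_bigr do rewrite mulnDr.
  rewrite big_split /=; congr (_ + _); rewrite (bigD1 (point_rep y)) ?point_rep_in //= eqxx muln1 projective_rep //.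
  by rewrite big1 ?addn0 // => x /andP[_ /negPf]; rewrite eq_sym => ->; rewrite muln0.
rewrite count_flatten sumnE !big_map big_enum -big_split /=.
rewrite -sum1_card big_distrr [RHS](eq_bigl (fun x => (x \in points k) && p x)) => [|x]; last by rewrite inE.
rewrite [RHS]big_mkcondr; apply: eq_bigr => x /multX mult_x.
by rewrite count_nseq -mulnDr subnK //; case: (p x); rewrite /= ?mul1n ?muln1.
Qed.

Lemma row_free_extend m k r (A : 'M[F]_(m, k)) :
  \rank A <= r -> r <= k -> exists2 B : 'M[F]_(r, k), row_free B & (A <= B)%MS.
Proof.
move=> le_Ar le_rk; exists (pid_mx r *m row_ebase A)%R.
  by rewrite /row_free mxrankMfree ?row_free_unit ?row_ebase_unit // rank_pid_mx.
apply/submxP; exists (col_ebase A *m pid_mx (\rank A))%R.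
rewrite mulmxA -[in RHS](mulmxA (col_ebase A)) mul_pid_mx (minn_idPl le_Ar).
by rewrite (minn_idPr le_Ar) mulmx_ebase.
Qed.

(** * The minihyper of a Griesmer code *)

Section GriesmerMultiset.
Variables (k d : nat) (X : seq 'rV[F]_k).
Hypotheses (k_gt0 : 0 < k) (Xd : forall u : 'rV[F]_k, u != 0%R -> d <= colwt X u).
Hypothesis sizeX : size X = griesmer q k d.
Local Notation s := (ceildiv d (q ^ k.-1)).

(** Deleting zero vectors changes no weight, so by the Griesmer bound none can be deleted. *)
Lemma griesmer_nonzero : all (fun x => x != 0%R) X.
Proof.
rewrite all_count eqn_leq count_size /= sizeX -size_filter.
rewrite -[X in griesmer _ X _](mxrank1 F k); apply: griesmer_bound => u _ nz_u.
apply: leq_trans (Xd nz_u) _; rewrite /colwt count_filter sub_count // => x /= xu.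
by rewrite xu; apply: contraNneq xu => ->; rewrite mul0mx.
Qed.

(* The words vanishing at [x] form a code of dimension [k - 1] with minimum
   distance at least [d] whose length is shorter by the multiplicity of [x]. *)
Lemma griesmer_mult x : x \in points k -> count (fun y => point_rep y == x) X <= s.
Proof.
rewrite inE => /andP[nz_x _].
have griesmer_k : griesmer q k d = griesmer q k.-1 d + s.
  by rewrite -{1}(prednK k_gt0) /griesmer big_ord_recr.
rewrite -(leq_add2l (griesmer q k.-1 d)) -griesmer_k -sizeX.
rewrite -(count_predC (fun y => point_rep y == x)) addnC leq_add2l -size_filter.
have <- : \rank (kermx x^T) = k.-1 by rewrite mxrank_ker mxrank_tr rank_rV nz_x subn1.
apply: griesmer_bound => u /sub_kermxP/eqP ux nz_u.
apply: leq_trans (Xd nz_u) _; rewrite /colwt count_filter sub_count // => y /= yu.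
rewrite yu; apply: contraNneq yu => rep_y.
by rewrite -[_ == _]negbK -(projective_rep y (projective_dot u)) rep_y negbK dot_eq0C.
Qed.

Local Notation M := (mset_compl s X).

Lemma count_compl_sub m (A : 'M[F]_(m, k)) :
  count (fun x => x <= A)%MS M + count (fun x => x <= A)%MS X = s * vq q (\rank A).
Proof.
rewrite -card_points_sub; apply: count_mset_compl; first exact: projective_sub.
  exact: griesmer_nonzero.
exact: griesmer_mult.
Qed.

Lemma count_compl_sub_dot m (A : 'M[F]_(m, k)) (u : 'rV[F]_k) : (A *m u^T != 0)%R ->
  count (fun x => (x <= A)%MS && (x *m u^T != 0)%R) M +
  count (fun x => (x <= A)%MS && (x *m u^T != 0)%R) X = s * q ^ (\rank A).-1.
Proof.
move=> Au; rewrite -(card_points_sub_dot Au); apply: count_mset_compl.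
- exact: (projectiveI (projective_sub A) (projective_dot u)).
- exact: griesmer_nonzero.
exact: griesmer_mult.
Qed.

Lemma size_compl : size M + size X = s * vq q k.
Proof.
have := count_compl_sub (1%:M : 'M[F]_k); rewrite mxrank1 => <-.
rewrite -!count_predT.
by congr (_ + _); apply: eq_count => x; rewrite submx1.
Qed.

Lemma colwt_compl (u : 'rV[F]_k) : u != 0%R -> colwt M u + colwt X u = s * q ^ k.-1.
Proof.
move=> nz_u; have := @count_compl_sub_dot _ (1%:M : 'M[F]_k) u.
rewrite mul1mx trmx_eq0 mxrank1 => /(_ nz_u) <-.
by congr (_ + _); apply: eq_count => x; rewrite submx1.
Qed.

(** Subtract [colwt_compl] from [size_compl] and use [vq q k = vq q k.-1 + q ^ k.-1]. Hyperplanes of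
    least value are thus the forms of least weight. *)
Lemma hyp_value_compl (u : 'rV[F]_k) : u != 0%R ->
  hyp_value M u = s * vq q k.-1 + colwt X u - size X.
Proof.
move=> /colwt_compl; move: size_compl (colwtE M u).
rewrite -[in vq q k](prednK k_gt0) vqS // mulnDr => ? ? ?.
lia.
Qed.

Lemma minihyper_compl : (exists2 u : 'rV[F]_k, u != 0%R & colwt X u = d) ->
  is_minihyper (s * vq q k - size X) (s * vq q k.-1 + d - size X) M.
Proof.
case=> u0 nz_u0 u0d; split.
- apply/allP => x /flatten_mapP[y]; rewrite mem_enum inE => /andP[nz_y _].
  by rewrite mem_nseq => /andP[_ /eqP->].
- by rewrite -size_compl addnK.
- by move=> u nz_u; rewrite hyp_value_compl // leq_sub2r // leq_add2l Xd.
by exists u0 => //; rewrite hyp_value_compl // u0d.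
Qed.

End GriesmerMultiset.

(** * Restriction to a subspace containing the minihyper *)

Lemma mh_rank_sub k m (P : seq 'rV[F]_k) (B : 'M[F]_(m, k)) :
  ((\matrix_(i < size P) nth 0 P i)%R <= B)%MS -> all (fun x => x <= B)%MS P.
Proof.
move=> /row_subP PB; apply/(all_nthP 0%R) => i lt_i.
by have := PB (Ordinal lt_i); rewrite rowK.
Qed.

Lemma card_mulmx_preim m n (A : 'M[F]_(m, n)) (W : {set 'rV[F]_n}) :
  row_full A -> #|[set u : 'rV[F]_m | (u *m A)%R \in W]| = q ^ (m - n) * #|W|.
Proof.
move=> fullA; rewrite -sum1_card (partition_big (fun u => u *m A)%R (mem W)) /=; last first.
  by move=> u; rewrite inE.
rewrite mulnC -sum_nat_const; apply: eq_bigr => w Ww.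
have [v wE] : exists v, w = (v *m A)%R by apply/submxP; apply: submx_full.
have := card_mulmx_fiber A v; rewrite (eqP fullA) -wE sum1_card => <-.
apply: eq_card => u; rewrite [RHS]inE; apply/andP/eqP => [[_ /eqP//]|uA].
by rewrite inE uA.
Qed.

Lemma griesmer_minihyper_bound k (X : seq 'rV[F]_k) d k' :
    let s := ceildiv d (q ^ k.-1) in
    let f := s * vq q k - size X in
    let m := s * vq q k.-1 + d - size X in
    (forall u : 'rV[F]_k, u != 0%R -> d <= colwt X u) ->
    (exists2 u : 'rV[F]_k, u != 0%R & colwt X u = d) ->
    size X = griesmer q k d -> 0 < k' < k -> 0 < f ->
    (forall P : seq 'rV[F]_k, is_minihyper f m P -> mh_rank P <= k') ->
  q ^ (k - k') * emin F (size X + s * vq q k' - s * vq q k) k'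
    <= #|[set u : 'rV[F]_k | (u != 0%R) && (colwt X u == d)]|.
Proof.
move=> s f m Xd ex_d sizeX /andP[k'_gt0 lt_k'] f_gt0 max_k'.
have k_gt0 : 0 < k by apply: leq_trans lt_k'.
pose M := mset_compl s X.
have sizeM : size M + size X = s * vq q k by apply: size_compl.
have wtM (u : 'rV[F]_k) : u != 0%R -> colwt M u + colwt X u = s * q ^ k.-1 by apply: colwt_compl.
(* Maximality of [k'] only bounds the rank of [M] above, so its span is enlarged to dimension
   exactly [k']. *)
have [B freeB MB] :
    exists2 B : 'M[F]_(k', k), row_free B & ((\matrix_(i < size M) nth 0 M i)%R <= B)%MS.
  by apply: row_free_extend (ltnW lt_k'); apply/max_k'/minihyper_compl.
have rankB : \rank B = k' by apply/eqP.
move/mh_rank_sub/allP: MB => MB.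
pose X' := [seq x <- X | (x <= B)%MS].
have sizeX' : size M + size X' = s * vq q k'.
  rewrite -rankB -(count_compl_sub k_gt0 Xd sizeX) size_filter; congr (_ + _).
  by rewrite -[LHS]count_predT; apply: eq_in_count => x /MB->.
have wtX' (u : 'rV[F]_k) : (B *m u^T != 0)%R -> colwt M u + colwt X' u = s * q ^ k'.-1.
  move=> Bu; rewrite -rankB -(count_compl_sub_dot k_gt0 Xd sizeX Bu) /colwt count_filter.
  congr (_ + _); first by apply: eq_in_count => x /MB->.
  by apply: eq_count => x /=; rewrite andbC.
(* The coordinates of [X'] in the basis [B]; a form [u] restricts to [u *m B^T] in these
   coordinates. *)
pose Y := [seq (x *m pinvmx B)%R | x <- X'].
have sizeY : size Y = size X' by rewrite size_map.
have wtY (u : 'rV[F]_k) : colwt Y (u *m B^T)%R = colwt X' u.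
  rewrite /colwt count_map; apply: eq_in_count => x; rewrite mem_filter => /andP[xB _] /=.
  by rewrite trmx_mul trmxK mulmxA mulmxKpV.
have fullB : row_full B^T%R by rewrite /row_full mxrank_tr rankB.
have ext (w : 'rV[F]_k') : exists u : 'rV[F]_k, w = (u *m B^T)%R.
  by apply/submxP; apply: submx_full.
(* As [M] lies inside [B], its weight cancels between [wtM] and [wtX']. *)
have wtYX (u : 'rV[F]_k) : (u *m B^T != 0)%R -> colwt Y (u *m B^T)%R + s * q ^ k.-1 = colwt X u + s * q ^ k'.-1.
  move=> uB; have Bu : (B *m u^T != 0)%R by rewrite -trmx_eq0 trmx_mul trmxK.
  have nz_u : u != 0%R by apply: contraNneq uB => ->; rewrite mul0mx.
  by rewrite wtY -(wtX' u Bu) -(wtM u nz_u); lia.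
have [u0 nz_u0 u0d] := ex_d.
have le_d : d <= s * q ^ k.-1 by rewrite -ceildiv_le // expn_gt0 q_gt0.
(* Otherwise [d = s q^(k-1)], hence [size X = s v_k] and the minihyper is empty. *)
have u0B : (u0 *m B^T != 0)%R.
  apply: contraTneq f_gt0 => uB0; rewrite -leqNgt leqn0 subn_eq0 sizeX.
  have wtM0 : colwt M u0 = 0.
    apply/eqP; rewrite -leqn0 leqNgt -has_count -all_predC; apply/allP => x /MB /submxP[y ->] /=.
    by rewrite -mulmxA -[(B *m _)%R]trmxK trmx_mul trmxK uB0 trmx0 mulmx0 eqxx.
  have dE : d = s * q ^ k.-1 by rewrite -(wtM _ nz_u0) wtM0 u0d.
  by rewrite dE griesmer_simplex.
pose d' := colwt Y (u0 *m B^T)%R.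
have d'E : d' + s * q ^ k.-1 = d + s * q ^ k'.-1 by rewrite wtYX // u0d.
pose W := [set w : 'rV[F]_k' | (w != 0%R) && (colwt Y w == d')].
have le_emin : emin F (size Y) k' <= #|W|.
  apply: emin_le => // [w nz_w||].
  - have [u wE] := ext w; rewrite wE -(leq_add2r (s * q ^ k.-1)) d'E wtYX -?wE //.
    by rewrite leq_add2r Xd //; apply: contraNneq nz_w => u0E; rewrite wE u0E mul0mx.
  - by exists (u0 *m B^T)%R.
  (* This turns the Griesmer equality for [X] into [size Y <= griesmer q k' d'], the optimality
     condition of [emin_le]. *)
  have := griesmer_simplexB q_gt1 (ltnW lt_k') le_d d'E.
  by rewrite -sizeX sizeY; lia.
have -> : size X + s * vq q k' - s * vq q k = size Y by rewrite sizeY; lia.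
apply: leq_trans (leq_mul (leqnn _) le_emin) _.
(* Each [w] in [W] is the restriction of [q ^ (k - k')] forms [u], all of weight [d] on [X] by
   [wtYX]. *)
rewrite -(card_mulmx_preim _ fullB); apply/subset_leq_card/subsetP => u.
rewrite !inE => /andP[uB /eqP wt_u]; apply/andP; split.
  by apply: contraNneq uB => ->; rewrite mul0mx.
by rewrite -(eqn_add2r (s * q ^ k'.-1)) -wtYX // wt_u d'E.
Qed.

End Geometry.

Theorem theorem8 (F : finFieldType) (n k d : nat) (C : 'M[F]_n) (k' : nat) :
  let q := #|F| in
  let s := ceildiv d (q ^ k.-1) in
  \rank C = k ->
  mindist C = d ->
  n = griesmer q k d ->
  k' < k ->
  (exists2 P : seq 'rV[F]_k,
      is_minihyper (s * vq q k - n) (s * vq q k.-1 + d - n) P & mh_rank P = k') ->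
  (forall P : seq 'rV[F]_k,
      is_minihyper (s * vq q k - n) (s * vq q k.-1 + d - n) P -> mh_rank P <= k') ->
  (q ^ (k - k') * emin F (n + s * vq q k' - s * vq q k) k' <= Aw d C).

Proof.
move=> q s rankC minC n_griesmer lt_k' [P P_minihyper rankP] max_k'.
case: (posnP k') => [->|k'_gt0]; first by rewrite emin0 muln0.
subst k; have C_gt0 : 0 < \rank C by apply: leq_trans lt_k'.
have [freeG eqGC] := (row_base_free C, eq_row_base C).
rewrite (Aw_colwt freeG eqGC).
pose X := columns (row_base C).
have sizeX : size X = n by apply: size_columns.
(* Otherwise the given minihyper [P] would be empty, hence of rank 0 instead of [k']. *)
have f_gt0 : 0 < s * vq q (\rank C) - n.
  case: P_minihyper => _ <- _ _; rewrite lt0n; apply: contraTneq k'_gt0 => sizeP.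
  by rewrite -rankP /mh_rank -leqNgt (leq_trans (rank_leq_row _)) // sizeP.
have := @griesmer_minihyper_bound F _ X d k'; rewrite sizeX; apply=> //.
- by move=> u nz_u; rewrite -minC (mindist_le freeG eqGC).
- by rewrite -minC; apply: (mindist_attained freeG eqGC).
by rewrite k'_gt0.
Qed.
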